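(* Let $X$ be a continuum and $n\in\mathbb N$. Let $A,C\in 2^X$ be such that $C$ is a union of some components of $A$. Then: (1) if $A\in CC_n(X)$, then $C\in CC_n(X)$; (2) if $A\in NWC_n(X)$, then $C\in NWC_n(X)$; (3) if $A\in NC_n(X)$, then $C\in NC_n(X)$.
   Context: All spaces are metric; a continuum is a compact connected space with more than one point; $\mathbb N=\{1,2,\dots\}$. For a non-empty space $Y$ and $n\in\mathbb N$: $2^Y$ is the set of non-empty compact subsets of $Y$; $F_n(Y)$ is the set of elements of $2^Y$ with at most $n$ points. A non-empty space $Y$ is (interiors taken in $Y$): - $n$-$Q1$ if there exists $B\in F_n(Y)$ such that for each $x\in Y$ there exists a continuum $D\subset Y$ with $x\in \mathrm{int}(D)$ and $B\cap D\neq\emptyset$; - $n$-$Q2$ if there exists $B\in F_n(Y)$ such that for each $x\in Y$ there exists a continuum $D\subset Y$ with $x\in D$ and $B\cap D\neq\emptyset$. For a non-degenerate compact metric space $X$: $CC_n(X)=\{A\in 2^X: A=X$ or $X-A$ is $n$-$Q1\}$; $NWC_n(X)=\{A\in 2^X: A=X$ or $X-A$ is $n$-$Q2\}$; $NC_n(X)=\{A\in 2^X: X-A$ has at most $n$ components$\}$. *)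

(* Defs.v *)
From HB Require Import structures.
From mathcomp Require Import all_boot all_order all_algebra.
From mathcomp Require Import all_classical all_reals all_analysis.

Set Implicit Arguments.
Unset Strict Implicit.
Unset Printing Implicit Defensive.

Local Open Scope classical_set_scope.
Local Open Scope card_scope.

(* Spaces other than the ambient one occur only as subsets [Y] of it.
   Compactness and connectedness of a subset do not depend on the ambient
   space, so only interiors need the topology of [Y] itself. *)

Definition continuum (T : topologicalType) (D : set T) : Prop :=
  [/\ compact D, connected D & exists x y, [/\ D x, D y & x <> y]].

Definition hyperspace (T : topologicalType) (Y : set T) : set (set T) :=
  [set A | [/\ A `<=` Y, A !=set0 & compact A]].

Definition hyperF (n : nat) (T : topologicalType) (Y : set T) : set (set T) :=
  [set A | hyperspace Y A /\ A #<= `I_n].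

(* In [subspace Y] the neighbourhoods of a point of [Y] are the traces of its
   ambient neighbourhoods; points outside [Y] are isolated in it, but the
   quantification over [x] is limited to [Y]. *)
Definition relint (T : topologicalType) (Y D : set T) : set T :=
  @interior (subspace Y) D.

Definition Q1 (n : nat) (T : topologicalType) (Y : set T) : Prop :=
  Y !=set0 /\
  exists2 B, hyperF n Y B &
    forall x, Y x ->
      exists D, [/\ continuum D, D `<=` Y, relint Y D x & B `&` D !=set0].

Definition Q2 (n : nat) (T : topologicalType) (Y : set T) : Prop :=
  Y !=set0 /\
  exists2 B, hyperF n Y B &
    forall x, Y x ->
      exists D, [/\ continuum D, D `<=` Y, D x & B `&` D !=set0].

Definition components (T : topologicalType) (Y : set T) : set (set T) :=
  connected_component Y @` Y.

Definition CC (n : nat) (X : topologicalType) : set (set X) :=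
  [set A | hyperspace [set: X] A /\ (A = [set: X] \/ Q1 n (~` A))].

Definition NWC (n : nat) (X : topologicalType) : set (set X) :=
  [set A | hyperspace [set: X] A /\ (A = [set: X] \/ Q2 n (~` A))].

Definition NC (n : nat) (X : topologicalType) : set (set X) :=
  [set A | hyperspace [set: X] A /\ components (~` A) #<= `I_n].

(* Main.v *)
Require Import Defs.
From HB Require Import structures.
From mathcomp Require Import all_boot all_order all_algebra.
From mathcomp Require Import all_classical all_reals all_analysis.

(** Write [U] and [V] for the complements of [A] and [C], so that [U] is
    contained in the open set [V].  Everything rests on one fact
    ([boundary_bumping_around]): each point [x] of [V] outside [U] has an open
    neighbourhood [W] whose closure lies in [V], whose boundary lies in [U], and
    for which every component of [closure W] meets the boundary of [W].

    To find [W], recall that in a compact Hausdorff space components and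
    quasi-components coincide.  The component of [x] in [A] misses the compact
    set [C], hence [A] splits into two disjoint closed pieces, one around [x] and
    one around [C]; normality separates them by an open set [W].  Since [C] is
    not empty, [W] is not the whole space, and a component of [closure W] missing
    the boundary would yield, again by quasi-components, a proper clopen
    non-empty subset of the connected space [X].

    So [x] is joined to a point of [U] by a continuum inside [V].  Hence the
    finite set [B] that works for [U] works for [V] in (2), and every component
    of [V] contains a component of [U], which gives (3).  For (1), cover the
    compact boundary of [W] by a compact subset [Z] of [U] all of whose
    components meet [B].  Every component of [closure W `|` Z] then meets the
    finite set [B]; there are finitely many of them and all are closed, so the
    one through [x] is a neighbourhood of [x]. *)

Set Implicit Arguments.
Unset Strict Implicit.
Unset Printing Implicit Defensive.

Local Open Scope classical_set_scope.

(** * Compactness *)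

(** The finite subcover property rephrased: an ideal of sets containing a
    neighbourhood of each point of a compact set contains the compact set. In
    this form no cover has to be indexed and no choice of neighbourhoods is
    made. *)
Lemma compact_ideal (T : topologicalType) (P : set (set T)) (K : set T) :
  compact K -> P set0 ->
  (forall S S', S `<=` S' -> P S' -> P S) ->
  (forall S S', P S -> P S' -> P (S `|` S')) ->
  (forall x, K x -> exists2 S, nbhs x S & P S) -> P K.
Proof.
move=> cK P0 Psub PU Ploc; apply: contrapT => nPK.
(* If [K] escapes the ideal, the complements in [K] of its members generate a
   proper filter, and no point of [K] can be a cluster point of it. *)
pose F := filter_from P (fun S => K `\` S).
have PF : ProperFilter F.
  apply: filter_from_proper; last first.
    move=> S PS; apply/set0P/negP => /eqP; rewrite setD_eq0 => KS.
    exact: nPK (Psub _ _ KS PS).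
  apply: filter_from_filter; first by exists set0.
  move=> S S' PS PS'; exists (S `|` S'); first exact: PU.
  by move=> z [Kz nS]; split; split => // Sz; apply: nS; [left|right].
have FK : F K by exists set0 => // z [].
have [x [Kx Fx]] := cK F PF FK.
have [S xS PS] := Ploc x Kx.
have FS : F (K `\` S) by exists S.
by have [z [[]]] := Fx _ _ FS xS.
Qed.

Lemma normal_disjoint_open (T : topologicalType) (A B : set T) :
  normal_space T -> closed A -> closed B -> A `&` B = set0 ->
  exists U V, [/\ open U, open V, A `<=` U, B `<=` V & U `&` V = set0].
Proof.
move=> nT cA cB AB.
have [|N /set_nbhsP [U [oU AU UN]] NB] := nT A cA (~` B).
  by apply/set_nbhsP; exists (~` B); split; rewrite ?openC//; exact/disjoints_subset.
exists U, (~` closure N); split => //.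
- by rewrite openC; exact: closed_closure.
- exact: subsetCr.
- by apply/disjoints_subset; rewrite setCK => z /UN /subset_closure.
Qed.

(** * Components and quasi-components of a compact Hausdorff space *)

Lemma connected_component_mono (T : topologicalType) (Y Z : set T) (x : T) :
  Y `<=` Z -> connected_component Y x `<=` connected_component Z x.
Proof.
by move=> YZ y [D [Dx DY cD] Dy]; exists D => //; split => // z /DY /YZ.
Qed.

Definition clopen_in (T : topologicalType) (Y P : set T) :=
  [/\ P `<=` Y, closed P & closed (Y `\` P)].

Lemma clopen_inI (T : topologicalType) (Y P P' : set T) :
  clopen_in Y P -> clopen_in Y P' -> clopen_in Y (P `&` P').
Proof.
move=> [PY cP cYP] [P'Y cP' cYP']; split.
- by move=> z [/PY].
- exact: closedI.
- by rewrite setDIr; apply: closedU.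
Qed.

Definition quasicomponent (T : topologicalType) (Y : set T) (x : T) : set T :=
  [set y | forall P, clopen_in Y P -> P x -> P y].

(** The relatively clopen sets containing [x] are stable under intersection, so
    compactness of [G] lets a single one of them avoid all of [G]. *)
Lemma quasicomponent_separation (T : topologicalType) (Y G : set T) (x : T) :
  closed Y -> Y x -> compact G -> G `<=` ~` quasicomponent Y x ->
  exists P, [/\ clopen_in Y P, P x & P `<=` ~` G].
Proof.
move=> cY Yx cG Gq.
pose I S := exists P, [/\ clopen_in Y P, P x & P `<=` ~` S].
suff : I G by [].
apply: compact_ideal => //.
- exists Y; split => //; last by rewrite setC0.
  by split => //; rewrite setDv; exact: closed0.
- move=> S S' SS' [P [? ? PS']]; exists P; split => //.
  by apply: subset_trans PS' _; exact: subsetC.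
- move=> S S' [P [oP Px PS]] [P' [oP' P'x PS']]; exists (P `&` P'); split => //.
    exact: clopen_inI.
  by move=> z [/PS nS /PS' nS'] [].
- move=> g /Gq /existsNP [P] /not_implyP [PY] /not_implyP [Px nPg].
  have [_ cP _] := PY.
  exists (~` P); last by exists P; split => //; rewrite setCK.
  by apply: open_nbhs_nbhs; split => //; rewrite openC.
Qed.

(** Connectedness is where normality enters: a splitting of the quasi-component
    extends to disjoint open sets, and by compactness some relatively clopen set
    lies in their union, so that each of its halves is relatively clopen. *)
Lemma quasicomponent_sub_component (T : topologicalType) (Y : set T) (x : T) :
  hausdorff_space T -> compact [set: T] -> closed Y -> Y x ->
  quasicomponent Y x `<=` connected_component Y x.
Proof.
move=> hT cT cY Yx.
have qx : quasicomponent Y x x by move=> P.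
have qY : quasicomponent Y x `<=` Y.
  by move=> y; apply => //; split => //; rewrite setDv; exact: closed0.
have cq : closed (quasicomponent Y x).
  move=> y cly P PY Px; have [_ cP _] := PY.
  by apply: cP => B /cly [z [qz Bz]]; exists z; split => //; exact: qz.
apply: connected_component_max => // E Ene [U oU EU] [D cD ED].
have cE : closed E by rewrite ED; exact: closedI.
have cqE : closed (quasicomponent Y x `\` E).
  have -> : quasicomponent Y x `\` E = quasicomponent Y x `&` ~` U.
    rewrite EU; apply/seteqP; split => z [qz nz]; split => //.
      by move=> Uz; apply: nz.
    by case.
  by apply: closedI => //; rewrite closedC.
have [U1 [U2 [oU1 oU2 EU1 qU2 U12]]] := normal_disjoint_open
  (compact_normal hT cT) cE cqE (setDIK _ _).
have cG : compact (Y `\` (U1 `|` U2)).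
  apply: (subclosed_compact _ cT) => //; rewrite setDE.
  by apply: closedI => //; rewrite closedC; exact: openU.
have [|P [[PY cP cYP] Px PG]] := quasicomponent_separation cY Yx cG.
  move=> z [_ nz] qz; apply: nz.
  by case: (pselect (E z)) => Ez; [left; exact: EU1|right; exact: qU2].
have PU z : P z -> U1 z \/ U2 z.
  by move=> Pz; apply: contrapT => nU; apply: (PG z Pz); split => //; exact: PY.
(* On [P], lying in one of the two open sets is the same as avoiding the other,
   so each half of [P] is closed and has a closed complement in [Y]. *)
have half U3 U4 : open U3 -> open U4 -> U3 `&` U4 = set0 ->
    (forall z, P z -> U3 z \/ U4 z) -> clopen_in Y (P `&` U3).
  move=> o3 o4 U34 PU34; split; first by move=> z [/PY].
  - have -> : P `&` U3 = P `&` ~` U4; last first.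
      by apply: closedI => //; rewrite closedC.
    apply/seteqP; split => z [Pz Uz]; split => //.
      by move=> U4z; rewrite -[False]/(set0 z) -U34.
    by case: (PU34 z Pz).
  - have -> : Y `\` (P `&` U3) = (Y `\` P) `|` (Y `&` ~` U3).
      by rewrite setDIr [Y `\` U3]setDE.
    by apply: closedU => //; apply: closedI => //; rewrite closedC.
have [Ex|nEx] := pselect (E x).
  apply/seteqP; split => [z|z qz]; first by rewrite EU => -[].
  have [_ U1z] := qz _ (half U1 U2 oU1 oU2 U12 PU) (conj Px (EU1 _ Ex)).
  apply: contrapT => nEz.
  by rewrite -[False]/(set0 z) -U12; split => //; exact: qU2.
have U21 : U2 `&` U1 = set0 by rewrite setIC.
have PU' z : P z -> U2 z \/ U1 z by move=> /PU [|]; [right|left].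
have [e Ee] := Ene.
have qe : quasicomponent Y x e by move: Ee; rewrite EU => -[].
have [_ U2e] := qe _ (half U2 U1 oU2 oU1 U21 PU') (conj Px (qU2 _ (conj qx nEx))).
have : (U1 `&` U2) e by split => //; exact: EU1.
by rewrite U12.
Qed.

Lemma component_separation (T : topologicalType) (Y G : set T) (x : T) :
  hausdorff_space T -> compact [set: T] -> closed Y -> Y x -> closed G ->
  G `<=` ~` connected_component Y x ->
  exists P, [/\ clopen_in Y P, P x & P `<=` ~` G].
Proof.
move=> hT cT cY Yx cG Gx; apply: quasicomponent_separation => //.
  exact: (subclosed_compact cG cT).
apply: subset_trans Gx _; apply: subsetC.
exact: quasicomponent_sub_component.
Qed.

(** * Boundary bumping *)

(** Otherwise the boundary could be split off from the component by a relatively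
    clopen subset of [closure W]; lying in [W], this subset would be clopen in
    the whole connected space. *)
Lemma boundary_bumping (T : topologicalType) (W : set T) (x : T) :
  hausdorff_space T -> compact [set: T] -> connected [set: T] ->
  open W -> W <> [set: T] -> closure W x ->
  connected_component (closure W) x `&` (closure W `\` W) !=set0.
Proof.
move=> hT cT coT oW WT clWx; apply: contrapT => nmeet.
have cW : closed (closure W) by exact: closed_closure.
have cG : closed (closure W `\` W).
  by rewrite setDE; apply: closedI => //; rewrite closedC.
have Gx : closure W `\` W `<=` ~` connected_component (closure W) x.
  by move=> z Gz Cz; apply: nmeet; exists z.
have [P [[PW cP cWP] Px PG]] := component_separation hT cT cW clWx cG Gx.
have sPW : P `<=` W.
  by move=> z Pz; apply: contrapT => nW; apply: (PG z Pz); split => //; exact: PW.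
have PE : P = W `&` ~` (closure W `\` P).
  apply/seteqP; split => z.
    by move=> Pz; split; [exact: sPW|case].
  move=> [Wz nz]; apply: contrapT => nP.
  by apply: nz; split => //; exact: subset_closure.
have oP : open P by rewrite PE; apply: openI => //; rewrite openC.
have PT : P = [set: T].
  by apply: coT; [exists x|exists P; rewrite // setTI|exists P; rewrite // setTI].
by apply: WT; rewrite -subTset -PT.
Qed.

(** A point [x] of [A] outside the component-saturated set [C] lies on one side
    of a splitting of [A], and [C] on the other; [W] is an open set separating
    the two sides. *)
Lemma boundary_bumping_around (T : topologicalType) (A C : set T) (x : T) :
  hausdorff_space T -> compact [set: T] -> connected [set: T] ->
  closed A -> closed C -> C !=set0 -> C `<=` A ->
  (forall c, C c -> connected_component A c `<=` C) ->
  A x -> ~ C x ->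
  exists W, [/\ open W, W x, closure W `<=` ~` C, closure W `\` W `<=` ~` A &
    forall z, closure W z ->
      connected_component (closure W) z `&` (closure W `\` W) !=set0].
Proof.
move=> hT cT coT cA cC [c Cc] CA Csat Ax nCx.
have Cx : C `<=` ~` connected_component A x.
  move=> z Cz /connected_component_sym xz.
  exact: nCx (Csat z Cz x xz).
have [P [[PA cP cAP] Px PC]] := component_separation hT cT cA Ax cC Cx.
have [W [U [oW oU PW APU WU]]] := normal_disjoint_open
  (compact_normal hT cT) cP cAP (setDIK _ _).
have clWU : closure W `<=` ~` U.
  have /closure_id -> : closed (~` U) by rewrite closedC.
  by apply: closureS => z Wz Uz; rewrite -[False]/(set0 z) -WU.
have clWA z : closure W z -> A z -> P z.
  move=> clWz Az; apply: contrapT => nPz.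
  by apply: (clWU z clWz); exact: APU.
have WC : closure W `<=` ~` C.
  by move=> z clWz Cz; apply: (PC z) => //; apply: clWA => //; exact: CA.
exists W; split => //.
- exact: PW.
- by move=> z [clWz nWz] Az; apply: nWz; apply: PW; exact: clWA.
- move=> z clWz; apply: boundary_bumping => // WT.
  by apply: (WC c) => //; apply: subset_closure; rewrite WT.
Qed.

(** * Neighbourhoods in compact sets with finitely many components *)

(** Only finitely many components of [Z], all closed, meet [B]; removing those
    other than the component of [x] leaves an open set of [T] within which [Z]
    is reduced to this component. *)
Lemma nbhs_component (T : topologicalType) (Z B : set T) (x : T) :
  closed Z -> finite_set B -> nbhs x Z ->
  (forall z, Z z -> connected_component Z z `&` B !=set0) ->
  nbhs x (connected_component Z x).
Proof.
move=> cZ fB xZ ZB.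
pose others := \bigcup_(b in B `\` connected_component Z x)
  connected_component Z b.
have cO : closed others.
  apply: closed_bigcup; first exact: finite_setD.
  by move=> b _; exact: component_closed.
have xO : nbhs x (~` others).
  apply: open_nbhs_nbhs; split; first by rewrite openC.
  by move=> [b [_ nb]] /connected_component_sym.
near=> z.
have Zz : Z z by near: z.
have nOz : (~` others) z by near: z.
have [b [zb Bb]] := ZB z Zz; apply: contrapT => nxz.
apply: nOz; exists b; last exact: connected_component_sym.
split=> // xb; apply: nxz; apply: connected_component_trans xb _.
exact: connected_component_sym.
Unshelve. all: by end_near. Qed.

(** The sets that fit inside such a [Z] form an ideal: in a union [Z `|` Z']
    components can only grow, so they still meet [B]. *)
Lemma compact_hull_meeting (T : topologicalType) (U B K : set T) :
  compact K ->
  (forall x, K x -> exists D,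
    [/\ compact D, connected D, D `<=` U, nbhs x D & B `&` D !=set0]) ->
  exists Z, [/\ compact Z, Z `<=` U, K `<=` Z &
    forall z, Z z -> connected_component Z z `&` B !=set0].
Proof.
move=> cK KD.
pose I S := exists Z, [/\ compact Z, Z `<=` U, S `<=` Z &
  forall z, Z z -> connected_component Z z `&` B !=set0].
suff : I K by [].
apply: compact_ideal => //.
- by exists set0; split => //; exact: compact0.
- move=> S S' SS' [Z [? ? S'Z ?]]; exists Z; split => //.
  exact: subset_trans S'Z.
- move=> S S' [Z [cZ ZU SZ ZB]] [Z' [cZ' Z'U SZ' ZB']].
  exists (Z `|` Z'); split.
  + exact: compactU.
  + by move=> z [/ZU|/Z'U].
  + by move=> z [/SZ|/SZ']; [left|right].
  + move=> z [/ZB|/ZB'] [b [zb Bb]]; exists b; split => //;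
      move: zb; apply: connected_component_mono; [exact: subsetUl|exact: subsetUr].
- move=> x /KD [D [cD coD DU xD [b [Bb Db]]]]; exists D => //.
  exists D; split => // z Dz; exists b; split => //.
  exact: (connected_component_max Dz).
Qed.

Lemma relint_open (T : topologicalType) (Y D : set T) (x : T) :
  open Y -> Y x -> relint Y D x <-> nbhs x D.
Proof.
move=> oY Yx; have Yi : Y° x by move: oY; rewrite openE; apply.
by rewrite /relint /interior /= -(nbhs_subspace_interior Yi).
Qed.

(** * Components of nested sets *)

(** Each component of [V] is the union of the components of [V] through the
    points of a component of [U]. *)
Lemma card_components_le (T : topologicalType) (U V : set T) :
  U `<=` V ->
  (forall x, V x -> connected_component V x `&` U !=set0) ->
  (components V #<= components U)%card.
Proof.
move=> UV VU.
pose h (L : set T) := \bigcup_(y in L) connected_component V y.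
apply: card_le_trans (card_image_le h (components U)).
apply: subset_card_le => _ [x Vx <-].
have [u [xu Uu]] := VU x Vx.
exists (connected_component U u); first by exists u.
rewrite (same_connected_component xu); apply/seteqP; split => z.
  move=> [y /(connected_component_mono UV) uy yz].
  exact: connected_component_trans uy yz.
by move=> uz; exists u => //; exact: connected_component_refl.
Qed.

(** * Unions of components of a closed set *)

Theorem theorem3p20 (R : realType) (X : metricType R) (n : nat)
    (hX : continuum [set: X]) (hn : (0 < n)%N) (A C : set X)
    (hA : hyperspace [set: X] A) (hC : hyperspace [set: X] C)
    (hAC : exists2 S : set (set X),
       S `<=` components A & C = \bigcup_(K in S) K) :
  [/\ CC n A -> CC n C, NWC n A -> NWC n C & NC n A -> NC n C].
Proof.
have hT : hausdorff_space X by exact: metric_hausdorff.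
have [cT coT _] := hX.
have [_ _ kA] := hA; have [_ C0 kC] := hC.
have cA := compact_closed hT kA; have cC := compact_closed hT kC.
have [S SA CE] := hAC.
have CA : C `<=` A.
  by rewrite CE => z [K /SA [a _ <-]] /connected_component_sub.
have Csat c : C c -> connected_component A c `<=` C.
  rewrite CE => -[K SK Kc] z cz; exists K => //.
  move: (SA K SK) Kc => [a _ <-] ac; exact: connected_component_trans ac cz.
have UV : ~` A `<=` ~` C by exact: subsetC.
have oU : open (~` A) by rewrite openC.
have oV : open (~` C) by rewrite openC.
have bump x : A x -> ~ C x -> _ :=
  boundary_bumping_around hT cT coT cA cC C0 CA Csat.
(* When [A] is everything there is no point outside [C]: the boundary given by
   bumping would have to lie in the empty complement of [A]. *)
have CT : A = [set: X] -> C = [set: X].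
  move=> AT; apply/seteqP; split => // x _; apply: contrapT => nCx.
  have [|W [_ Wx _ WA Wbd]] := bump x _ nCx; first by rewrite AT.
  have [y [_ /WA]] := Wbd x (subset_closure Wx).
  by rewrite AT; apply.
have hF B : hyperF n (~` A) B -> hyperF n (~` C) B.
  by move=> [[BU B0 kB] Bn]; split => //; split => //; exact: subset_trans UV.
have kcl (W : set X) : compact (closure W).
  by apply: (subclosed_compact _ cT) => //; exact: closed_closure.
split.
- move=> [_ QA]; split => //.
  case: QA => [/CT|[U0 [B BF BQ]]]; [by left|right].
  split; first by have [u /UV] := U0; exists u.
  exists B; first exact: hF.
  move=> x Vx; have [Ax|nAx] := pselect (A x); last first.
    have [D [cD DU xD BD]] := BQ x nAx; exists D; split => //.
    + exact: subset_trans UV.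
    + by apply/relint_open => //; exact/(relint_open _ oU nAx).
  have [W [oW Wx WC WA Wbd]] := bump x Ax Vx.
  have kbd : compact (closure W `\` W).
    by rewrite setDE; apply: compact_closedI => //; rewrite closedC.
  have [|Z [kZ ZU WZ ZB]] := compact_hull_meeting (U := ~` A) (B := B) kbd.
    move=> y /WA Uy; have [D [[kD coD _] DU yD BD]] := BQ y Uy.
    by exists D; split => //; exact/(relint_open _ oU Uy).
  (* A component of [closure W] reaches the boundary of [W], hence [Z], and from
     there a point of [B] inside [Z]. *)
  pose Y := closure W `|` Z.
  have kY : compact Y by exact: compactU.
  have YB z : Y z -> connected_component Y z `&` B !=set0.
    case=> [/Wbd [y [zy /WZ Zy]]|/ZB [b [zb Bb]]].
      have [b [yb Bb]] := ZB y Zy; exists b; split => //.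
      apply: (connected_component_trans (y := y)).
        by move: zy; apply: connected_component_mono; exact: subsetUl.
      by move: yb; apply: connected_component_mono; exact: subsetUr.
    exists b; split => //; move: zb.
    by apply: connected_component_mono; exact: subsetUr.
  have Yx : Y x by left; exact: subset_closure.
  have nYx : nbhs x Y.
    apply: (@filterS _ _ _ W); last exact: open_nbhs_nbhs.
    by move=> z Wz; left; exact: subset_closure.
  have cY : closed Y by exact: compact_closed.
  have [[BU _ _] Bn] := BF.
  have fB : finite_set B by apply: card_le_finite Bn _; exact: finite_II.
  have [b [xb Bb]] := YB x Yx.
  have YV : Y `<=` ~` C by move=> z [/WC|/ZU /UV].
  exists (connected_component Y x); split.
  + split; [|exact: component_connected|].
      apply: (subclosed_compact _ cT) => //; exact: component_closed.
    exists x, b; split => //; first exact: connected_component_refl.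
    by move=> xbE; apply: (BU b Bb); rewrite -xbE.
  + exact: subset_trans (@connected_component_sub _ _ _) YV.
  + by apply/relint_open => //; exact: (nbhs_component cY fB).
  + by exists b.
- move=> [_ QA]; split => //.
  case: QA => [/CT|[U0 [B BF BQ]]]; [by left|right].
  split; first by have [u /UV] := U0; exists u.
  exists B; first exact: hF.
  move=> x Vx; have [Ax|nAx] := pselect (A x); last first.
    have [D [cD DU Dx BD]] := BQ x nAx; exists D; split => //.
    exact: subset_trans UV.
  have [W [oW Wx WC WA Wbd]] := bump x Ax Vx.
  have clWx := subset_closure Wx.
  have [y [xy /WA Uy]] := Wbd x clWx.
  have [D [[kD coD _] DU Dy [b [Bb Db]]]] := BQ y Uy.
  exists (connected_component (closure W) x `|` D); split.
  + split.
    * apply: compactU => //; apply: (subclosed_compact _ cT) => //.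
      by apply: component_closed; exact: closed_closure.
    * by apply: connectedU => //; [exists y|exact: component_connected].
    * exists x, y; split; [|by right|by move=> xyE; apply: Uy; rewrite -xyE].
      by left; exact: connected_component_refl.
  + by move=> z [/connected_component_sub /WC|/DU /UV].
  + by left; exact: connected_component_refl.
  + by exists b; split => //; right.
- move=> [_ NA]; split => //; apply: card_le_trans NA.
  apply: card_components_le => // x Vx.
  have [Ax|nAx] := pselect (A x); last first.
    by exists x; split => //; exact: connected_component_refl.
  have [W [oW Wx WC WA Wbd]] := bump x Ax Vx.
  have [y [xy /WA Uy]] := Wbd x (subset_closure Wx).
  by exists y; split => //; move: xy; exact: connected_component_mono.
Qed.
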